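(* Let $X$ be a Banach space, let $p>1$ with conjugate exponent $p_*$, and let $Y$ be a $p$-smooth Banach space. Let $A\colon X\to Y$ be bounded linear, $\mathcal{R}\colon X\to[0,+\infty]$ convex, lower semi-continuous and coercive, $y^\dagger\in Y$, and let $x^\dagger$ be an $\mathcal{R}$-minimising solution of $Ax=y^\dagger$. Assume that $\omega^\dagger\in Y^*$ satisfies $A^*\omega^\dagger\in\partial\mathcal{R}(x^\dagger)$. Assume further that there exists an index function $\Phi$ such that $$\langle \omega-\omega^\dagger,\,J_{p_*}(\omega^\dagger)\rangle\le \Phi\bigl(\mathcal{D}^*_{x^\dagger}(A^*\omega;A^*\omega^\dagger)\bigr)\qquad\text{for every }\omega\in Y^*.$$ Denote by $\Psi$ the conjugate of the convex mapping $t\mapsto\Phi^{-1}(t)$. Then there exists a constant $D$ depending only on $p$ and the Banach space $Y$ such that, for all $\alpha>0$ and $\delta>0$, all $y^\delta\in Y$ with $\|y^\delta-y^\dagger\|\le\delta$, and every minimiser $x_\alpha^\delta$ of $\mathcal{T}_\alpha(\cdot;y^\delta)$ over $X$, $$\mathcal{D}_{A^*\omega^\dagger}(x_\alpha^\delta;x^\dagger)\le\Psi(\alpha^{p_*-1})+D\,\frac{\delta^p}{\alpha}.$$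
   Context: Conventions: $\langle\cdot,\cdot\rangle$ is the dual pairing; for $q>1$, $q_*$ is defined by $1/q+1/q_*=1$; $A^*\colon Y^*\to X^*$ is the adjoint; coercive means $\mathcal{R}(x)\to\infty$ as $\|x\|\to\infty$; $\partial\mathcal{R}$ is the convex subdifferential. The Tikhonov functional is $\mathcal{T}_\alpha(x;y)=\frac1p\|Ax-y\|^p+\alpha\mathcal{R}(x)$. An $\mathcal{R}$-minimising solution of $Ax=y^\dagger$ is an element $x^\dagger\in\arg\min\{\mathcal{R}(x):Ax=y^\dagger\}$. For $\xi\in\partial\mathcal{R}(x)$ the Bregman distance is $\mathcal{D}_\xi(\tilde x;x)=\mathcal{R}(\tilde x)-\mathcal{R}(x)-\langle\xi,\tilde x-x\rangle$. With $\mathcal{R}^*\colon X^*\to(-\infty,+\infty]$ the convex conjugate of $\mathcal{R}$ (the condition $A^*\omega^\dagger\in\partial\mathcal{R}(x^\dagger)$ implies $x^\dagger\in\partial\mathcal{R}^*(A^*\omega^\dagger)$), the dual Bregman distance is $\mathcal{D}^*_{x^\dagger}(\xi;A^*\omega^\dagger)=\mathcal{R}^*(\xi)-\mathcal{R}^*(A^*\omega^\dagger)-\langle\xi-A^*\omega^\dagger,x^\dagger\rangle\in[0,+\infty]$. Duality mapping on $Y^*$: $J_{p_*}(\omega^\dagger)$ is the element $y\in Y$ with $\langle\omega^\dagger,y\rangle=\|\omega^\dagger\|\|y\|$ and $\|y\|=\|\omega^\dagger\|^{p_*-1}$; if there are several such $y$, $J_{p_*}(\omega^\dagger)$ denotes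 one fixed choice. The modulus of smoothness of $Y$ is $\rho_Y(\tau)=\sup\{(\|y+\tilde y\|+\|y-\tilde y\|)/2-1: y,\tilde y\in Y,\ \|y\|=1,\ \|\tilde y\|=\tau\}$; $Y$ is $p$-smooth if there is $K>0$ with $\rho_Y(\tau)\le K\tau^p$ for all sufficiently small $\tau>0$. An index function is a strictly increasing, continuous, concave function $\Phi\colon[0,+\infty)\to[0,+\infty)$ with $\Phi(0)=0$. The conjugate of $\Phi^{-1}$ is $\Psi(s)=\sup\{st-\Phi^{-1}(t): t\in\Phi([0,+\infty))\}$. An inequality with right-hand side $\Phi(\mathcal{D}^*_{x^\dagger}(\cdot))$ is regarded as trivially satisfied where $\mathcal{D}^*_{x^\dagger}=+\infty$.
   Formalization: The source inequality is proved with the opposite sign, ⟨ω†−ω, J_{p_*}(ω†)⟩ ≤ Φ(D* ), since the printed sign makes the claim false; and for p>2 the space Y is assumed not one-dimensional, since the claim fails there. *)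

(* Defs.v *)
From HB Require Import structures.
From mathcomp Require Import all_boot all_order all_algebra.
From mathcomp Require Import all_classical all_reals all_analysis.

Set Implicit Arguments.
Unset Strict Implicit.
Unset Printing Implicit Defensive.

Import Order.TTheory GRing.Theory Num.Theory.
Import numFieldNormedType.Exports.

Local Open Scope classical_set_scope.
Local Open Scope ring_scope.

Section dual_space.
Context {R : realType}.

Record topdual (V : normedModType R) := Topdual {
  topdual_fun :> {linear V -> R^o} ;
  topdual_continuous : continuous topdual_fun }.

Definition dual_norm (V : normedModType R) (w : topdual V) : R :=
  sup [set `|w v| | v in [set v : V | `|v| <= 1]].

Lemma adjoint_continuous (V W : normedModType R) (A : {linear V -> W})
    (hA : bounded_near A (nbhs (0 : V))) (w : topdual W) :
  continuous (w \o A : {linear V -> R^o}).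
Proof.
move=> v; apply: continuous_comp; last exact: topdual_continuous.
exact: bounded_linear_continuous.
Qed.

Definition adjoint (V W : normedModType R) (A : {linear V -> W})
    (hA : bounded_near A (nbhs (0 : V))) (w : topdual W) : topdual V :=
  @Topdual V (w \o A) (@adjoint_continuous V W A hA w).

(* The values at w of the duality mapping J_r of the dual, restricted to the
   canonical image of Y in its bidual. *)
Definition duality_map (Y : normedModType R) (r : R) (w : topdual Y) : set Y :=
  [set y | w y = dual_norm w * `|y| /\ `|y| = dual_norm w `^ (r - 1)].

End dual_space.

Section smoothness.
Context {R : realType}.

(* Extended-real supremum, so that it is -oo for the trivial space. *)
Definition smoothness_modulus (Y : normedModType R) (tau : R) : \bar R :=
  ereal_sup [set (((`|yz.1 + yz.2| + `|yz.1 - yz.2|) / 2 - 1)%:E) |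
              yz in [set yz : Y * Y | `|yz.1| = 1 /\ `|yz.2| = tau]].

Definition p_smooth (Y : normedModType R) (p : R) : Prop :=
  exists2 K : R, 0 < K &
    \forall tau \near 0^'+, (smoothness_modulus Y tau <= (K * tau `^ p)%:E)%E.

Definition one_dimensional (Y : lmodType R) : Prop :=
  exists2 e : Y, e != 0 & forall y : Y, exists c : R, y = c *: e.

End smoothness.

Section convex_analysis.
Context {R : realType}.

Definition argmin (T : Type) (S : set T) (f : T -> \bar R) : set T :=
  [set x | S x /\ forall z, S z -> (f x <= f z)%E].

(* The library's [convex_function] is for real-valued functions only.  Here
   0 * +oo = 0, so the end points of the segment are harmless. *)
Definition convex_efun (V : lmodType R) (f : V -> \bar R) : Prop :=
  forall (x y : V) (t : R), 0 <= t <= 1 ->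
    (f (t *: x + (1 - t) *: y)%R <= t%:E * f x + (1 - t)%:E * f y)%E.

Definition coercive (V : normedModType R) (f : V -> \bar R) : Prop :=
  forall M : R, exists r : R, forall x : V, r <= `|x| -> (M%:E <= f x)%E.

Definition subdifferential (V : normedModType R) (f : V -> \bar R) (x : V) :
    set (topdual V) :=
  [set xi : topdual V | f x \is a fin_num /\
    forall z : V, (f x + (xi (z - x)%R)%:E <= f z)%E].

Definition conjugate (V : normedModType R) (f : V -> \bar R)
    (xi : topdual V) : \bar R :=
  ereal_sup [set ((xi x)%:E - f x)%E | x in [set: V]].

Definition bregman (V : normedModType R) (f : V -> \bar R) (xi : topdual V)
    (x' x : V) : \bar R :=
  (f x' - f x - (xi (x' - x)%R)%:E)%E.

Definition dual_bregman (V : normedModType R) (f : V -> \bar R) (x : V)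
    (xi' xi : topdual V) : \bar R :=
  (conjugate f xi' - conjugate f xi - (xi' x - xi x)%:E)%E.

Definition tikhonov (X Y : normedModType R) (A : X -> Y) (f : X -> \bar R)
    (p alpha : R) (y : Y) (x : X) : \bar R :=
  ((p^-1 * `|A x - y| `^ p)%:E + alpha%:E * f x)%E.

Definition R_minimising_solution (X Y : normedModType R) (A : X -> Y)
    (f : X -> \bar R) (y : Y) : set X :=
  argmin [set x | A x = y] f.

Definition halfline : set R := `[0, +oo[%classic.

(* Only the values of Phi on the half-line matter. *)
Definition index_function (Phi : R -> R) : Prop :=
  [/\ {in halfline &, {homo Phi : s t / s < t}},
      {within halfline, continuous Phi},
      convex_function (halfline : set (convex_lmodType R^o))
        (fun t => - Phi t),
      (forall t, halfline t -> halfline (Phi t)) &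
      Phi 0 = 0].

Definition index_inv_conjugate (Phi : R -> R) (s : R) : \bar R :=
  ereal_sup [set (s * t - pinv halfline Phi t)%:E | t in Phi @` halfline].

End convex_analysis.

(* Main.v *)
(** Write f = |.|^p / p on Y.  The p-smoothness of Y gives, with w = f'(k),
    f (k + h) <= f k + <w, h> + C |h|^p  for all k and h
    (for p > 2 it forces Y = 0, one-dimensional spaces being excluded).  With
    a = alpha^(q-1) and A x - ydelta = - a k, the minimality of x puts A^* w in
    the subdifferential of Rf at x.  Adding the two subgradient relations,
      D(x; xdag) = <w - wdag, A x - ydag> - d,
    where d is the dual Bregman distance of A^* w.  As wdag is a subgradient of
    f at j, comparing f at k, j and k + h yields
      <w - wdag, k - j> >= - <w - wdag, h> - C |h|^p;
    taking h = - (ydelta - ydag) / a cancels the noise term exactly and leaves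
      D(x; xdag) <= a <wdag - w, j> - d + C delta^p / alpha
                 <= a Phi(d) - d + C delta^p / alpha. *)

Require Import Defs.
From HB Require Import structures.
From mathcomp Require Import all_boot all_order all_algebra.
From mathcomp Require Import all_classical all_reals all_analysis.
From mathcomp Require Import ring lra.

Set Implicit Arguments.
Unset Strict Implicit.
Unset Printing Implicit Defensive.

Import Order.TTheory GRing.Theory Num.Theory.
Import numFieldNormedType.Exports.

Local Open Scope classical_set_scope.
Local Open Scope ring_scope.

(** * Scalar inequalities for real powers *)

Section power_inequalities.
Context {R : realType}.
Implicit Types a b s t x y p r : R.

(** Young's inequality for [a] and [b^(p - 1)], with exponents [p] and [p / (p - 1)]. *)
Lemma powR_tangent p a b : 1 < p -> 0 <= a -> 0 <= b ->
  b `^ p + p * b `^ (p - 1) * (a - b) <= a `^ p.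
Proof.
move=> p1 a0 b0; have p0 : 0 < p by lra.
have q0 : 0 < p / (p - 1) by rewrite divr_gt0 ?subr_gt0.
have pq : p^-1 + (p / (p - 1))^-1 = 1 by field; lra.
have := conjugate_powR a0 (powR_ge0 b (p - 1)) p0 q0 pq.
rewrite -powRrM mulrCA divff ?mulr1; last by lra.
rewrite -(ler_pM2l p0) -(mulr_powRB1 b0 p0).
move: (a `^ p) (b `^ (p - 1)) => A B.
have -> : p * (A / p + b * B / (p / (p - 1))) = A + (p - 1) * b * B.
  by field; lra.
lra.
Qed.

(** Each share [z / (x + y)] lies in [0, 1], hence is at most its [r]-th power; the shares of [x]
    and [y] add up to 1. *)
Lemma powR_subadditive r x y : 0 <= r <= 1 -> 0 <= x -> 0 <= y ->
  (x + y) `^ r <= x `^ r + y `^ r.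
Proof.
move=> /andP[r0 r1]; rewrite le_eqVlt => /predU1P[<- _|x0].
  by rewrite add0r ler_wpDl ?powR_ge0.
rewrite le_eqVlt => /predU1P[<-|y0].
  by rewrite addr0 ler_wpDr ?powR_ge0.
have xy0 : 0 < x + y by rewrite addr_gt0.
have part z : 0 < z -> z <= x + y -> z / (x + y) * (x + y) `^ r <= z `^ r.
  move=> z0 zxy; rewrite -[in leRHS](divfK (lt0r_neq0 xy0) z).
  rewrite powRM ?divr_ge0 ?(ltW z0) ?(ltW xy0)//.
  rewrite ler_wpM2r ?powR_ge0// ger1_powR// divr_gt0//=.
  by rewrite ler_pdivrMr// mul1r.
have px := part x x0; have py := part y y0.
rewrite (le_trans _ (lerD (px _) (py _))) ?lerDl ?lerDr ?(ltW x0) ?(ltW y0)//.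
by rewrite -mulrDl -mulrDl divff ?mul1r ?lt0r_neq0.
Qed.

Lemma powR_holder r x y : 0 <= r <= 1 -> 0 <= x -> 0 <= y ->
  `|x `^ r - y `^ r| <= `|x - y| `^ r.
Proof.
move=> r01; wlog yx : x y / y <= x.
  move=> h x0 y0; case: (leP y x) => [|/ltW] xy; first exact: h.
  by rewrite distrC (distrC x); exact: h.
move=> x0 y0; rewrite !ger0_norm ?subr_ge0 ?ge0_ler_powR//; last first.
  by case/andP: r01.
by rewrite lerBlDr (le_trans _ (powR_subadditive r01 _ _)) ?subrK ?subr_ge0.
Qed.

(** The tangent at [s + t] bounds the increment by [p (s + t)^(p - 1) t]; replacing this slope by
    the one at [s] costs a factor [|t|^(p - 1)], by Hölder continuity with exponent [p - 1 <= 1]. *)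
Lemma powR_expand p s t : 1 < p <= 2 -> 0 <= s -> 0 <= s + t ->
  (s + t) `^ p <= s `^ p + p * s `^ (p - 1) * t + p * `|t| `^ p.
Proof.
move=> /andP[p1 p2] s0 st0; have p0 : 0 < p by lra.
have := powR_tangent p1 s0 st0.
have : (s + t) `^ (p - 1) * t - s `^ (p - 1) * t <= `|t| `^ p.
  rewrite -mulrBl -(mulr_powRB1 (normr_ge0 t) p0).
  rewrite (le_trans (ler_norm _))// normrM mulrC ler_wpM2l//.
  have r01 : 0 <= p - 1 <= 1 by lra.
  by have := powR_holder r01 st0 s0; rewrite (addrC s t) addrK.
rewrite -(ler_pM2l p0); lra.
Qed.

Lemma le0_powR_near0 p a B : 1 < p ->
  (forall t, 0 < t -> t < 1 -> a <= B * t `^ (p - 1)) -> a <= 0.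
Proof.
move=> p1 aB; have lim0 : B * t `^ (p - 1) @[t --> 0^'+] --> 0.
  rewrite -[X in _ --> X](mulr0 B); apply: cvgMl_tmp.
  by apply: powR_cvg0; rewrite subr_gt0.
rewrite -(cvg_lim (@Rhausdorff R) lim0); apply: limr_ge.
  by apply/cvg_ex; eexists; exact: lim0.
by near=> t; apply: aB; near: t; [exact: nbhs_right_gt|exact: nbhs_right_lt].
Unshelve. all: by end_near. Qed.

End power_inequalities.

(** * The modulus of smoothness as a bound on second differences of the norm *)

Section smoothness_inequality.
Context {R : realType}.

Lemma p_smooth_sphere (Y : normedModType R) (p : R) : 1 < p -> p_smooth Y p ->
  exists2 C : R, 0 <= C & forall y h : Y, `|y| = 1 ->
    `|y + h| + `|y - h| <= 2 + C * `|h| `^ p.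
Proof.
move=> p1 [K K0] [e /= e0 he].
(* [K] serves [|h| < e], where the modulus bound holds; for [|h| >= e] the triangle inequality
   suffices, since then [|h| <= e^(1 - p) |h|^p]. *)
exists (2 * (K + e `^ (1 - p))) => [|y h y1].
  by rewrite mulr_ge0// addr_ge0 ?powR_ge0 ?ltW.
have [->|hN0] := eqVneq h 0.
  rewrite addr0 subr0 y1 normr0 powR0 ?mulr0; lra.
have h0 : 0 < `|h| by rewrite normr_gt0.
have [he1|he1] := ltP `|h| e.
  have := he `|h|; rewrite /ball/= sub0r normrN normr_id => /(_ he1 h0) hK.
  have /le_trans/(_ hK) : ((((`|y + h| + `|y - h|) / 2 - 1)%:E) <=
      smoothness_modulus Y `|h|)%E.
    by apply: ereal_sup_ubound; exists (y, h).
  rewrite lee_fin => hle; have := powR_ge0 e (1 - p).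
  move/mulr_ge0 => /(_ _ (powR_ge0 `|h| p)); lra.
have : `|h| <= e `^ (1 - p) * `|h| `^ p.
  rewrite -(mulr_powRB1 (normr_ge0 h)); last by lra.
  rewrite mulrCA ler_peMr// -[X in X <= _](powRr0 e) -(subrr (p - 1)).
  rewrite powRD ?(gt_eqF e0)/= ?implybT// mulrC opprB ler_wpM2l ?powR_ge0//.
  by rewrite ge0_ler_powR ?nnegrE ?(ltW e0)// subr_ge0 ltW.
have := ler_normD y h; have := ler_normB y h; rewrite y1.
have := mulr_ge0 (ltW K0) (powR_ge0 `|h| p); lra.
Qed.

Lemma p_smooth_homogeneous (Y : normedModType R) (p : R) :
  1 < p -> p_smooth Y p ->
  exists2 C : R, 0 <= C & forall y h : Y, y != 0 ->
    `|y + h| + `|y - h| <= 2 * `|y| + C * `|h| `^ p * `|y| `^ (1 - p).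
Proof.
move=> p1 /(p_smooth_sphere p1)[C C0 hC]; exists C => // y h yN0.
have y0 : 0 < `|y| by rewrite normr_gt0.
have scale (z : Y) : `| `|y|^-1 *: z| = `|y|^-1 * `|z|.
  by rewrite normrZ ger0_norm// invr_ge0.
have := hC (`|y|^-1 *: y) (`|y|^-1 *: h).
rewrite -scalerDr -scalerBr !scale mulVf ?gt_eqF// => /(_ erefl).
rewrite -(ler_pM2l y0) mulrDr !mulVKf ?gt_eqF// => /le_trans; apply.
rewrite powRM ?invr_ge0// powRB ?(lt_eqF p1)// powRr1//.
have -> : `|y|^-1 `^ p = (`|y| `^ p)^-1.
  by rewrite -[in LHS]powR_inv1// -powRrM mulN1r powRN.
rewrite le_eqVlt; apply/orP; left; apply/eqP; field.
by rewrite powR_eq0 (gt_eqF y0).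
Qed.

End smoothness_inequality.

(** * Smoothness exponents above 2 *)

Section dimension.
Context {R : realType}.

(* Halving the step divides the second difference by 4 but the error term by
   2 ^ p. *)
Lemma second_difference_le0 (f : R -> R) (p B : R) : 2 < p ->
  (forall t s, 0 <= s -> f (t + s) + f (t - s) <= 2 * f t + B * s `^ p) ->
  forall t s, 0 <= s -> f (t + s) + f (t - s) <= 2 * f t.
Proof.
move=> p2 fB t s s0; pose c := 4 * 2^-1 `^ p : R.
have c0 : 0 <= c by rewrite mulr_ge0 ?powR_ge0.
have c1 : c < 1.
  have : (2^-1 : R) `^ p < 2^-1 `^ 2.
    rewrite /powR gt_eqF ?invr_gt0// ltr_expR ltr_nM2r// ln_lt0//.
    by rewrite invr_gt0 invf_lt1//=; lra.
  by rewrite (@powR_mulrn _ _ 2)// /c; lra.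
(* The second difference of step [s] at [t] is the sum of those of step [s / 2] at [t + s / 2], at
   [t - s / 2] and twice at [t]; hence the 4 in [c]. *)
have step n : forall t s, 0 <= s ->
    f (t + s) + f (t - s) <= 2 * f t + B * c ^+ n * s `^ p.
  elim: n => [|n IHn] {}t {}s {}s0; first by rewrite expr0 mulr1 fB.
  have h0 : 0 <= s / 2 by lra.
  have := IHn t _ h0; have := IHn (t + s / 2) _ h0.
  have := IHn (t - s / 2) _ h0.
  have -> : t - s / 2 + s / 2 = t by ring.
  have -> : t - s / 2 - s / 2 = t - s by field.
  have -> : t + s / 2 - s / 2 = t by ring.
  have -> : t + s / 2 + s / 2 = t + s by field.
  rewrite powRM// exprS /c.
  set u := c ^+ n; set v := s `^ p; set w := 2^-1 `^ p; lra.
have lim0 : (fun n => 2 * f t + B * c ^+ n * s `^ p) @ \oo --> 2 * f t.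
  rewrite -[X in _ --> X]addr0; apply: cvgD; first exact: cvg_cst.
  rewrite -[X in _ --> X](mul0r (s `^ p)); apply: cvgMr_tmp.
  rewrite -[X in _ --> X](mulr0 B); apply: cvgMl_tmp.
  by apply: cvg_expr; rewrite ger0_norm.
rewrite -(cvg_lim (@Rhausdorff R) lim0); apply: limr_ge.
  by apply/cvg_ex; eexists; exact: lim0.
by apply: nearW => n; exact: step.
Qed.

(** On [[-T, T]] the minimum is attained, and it is positive because [y] is off the line through
    [e]. Beyond, [|t| |e| - |y| >= |y|] by the choice of [T]. *)
Lemma line_norm_bound (Y : normedModType R) (y e : Y) : e != 0 ->
  (forall c, y != c *: e) ->
  exists2 m : R, 0 < m & forall t, m <= `|y + t *: e|.
Proof.
move=> eN0 ye; pose T := 2 * `|y| / `|e|.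
have e0 : 0 < `|e| by rewrite normr_gt0.
have T0 : 0 <= T by rewrite divr_ge0 ?mulr_ge0.
pose f (t : R) := `|y + t *: e|.
have cf : continuous f.
  move=> t; apply: cvg_norm; apply: cvgD; first exact: cvg_cst.
  by apply: cvgZr_tmp; exact: cvg_id.
have TT : - T <= T by rewrite (le_trans _ T0)// oppr_le0.
have [c _ fc] := EVT_min TT (continuous_subspaceT cf).
exists (f c) => [|t].
  rewrite normr_gt0; apply: contra (ye (- c)) => /eqP h.
  by rewrite scaleNr -(addrK (c *: e) y) h sub0r.
have [tT|tT] := leP `|t| T; first by apply: fc; rewrite in_itv/= -ler_norml.
have /le_trans : f c <= f 0 by apply: fc; rewrite in_itv/= T0 oppr_le0 T0.
apply; rewrite /f scale0r addr0.
have := ler_normB (y + t *: e) y; rewrite addrAC subrr add0r normrZ.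
move: tT; rewrite -(ltr_pM2r e0) divfK ?gt_eqF//; lra.
Qed.

(** Along a line missing 0 the norm would have non-positive second differences, yet it grows at both
    ends. A one-dimensional space has no such line, and its modulus vanishes for small [tau]. *)
Lemma p_smooth_trivial (Y : normedModType R) (p : R) : 2 < p ->
  p_smooth Y p -> ~ one_dimensional Y -> forall y : Y, y = 0.
Proof.
move=> p2 hY dimN1 e; have p1 : 1 < p by lra.
apply: contrapT => /eqP eN0.
have [y ye] : exists y : Y, forall c, y != c *: e.
  apply: contrapT => nex; apply: dimN1; exists e => // y.
  apply: contrapT => nc; apply: nex; exists y => c.
  by apply/eqP => yc; apply: nc; exists c.
have [m m0 hm] := line_norm_bound eN0 ye.
have [C C0 hC] := p_smooth_homogeneous p1 hY.
have e0 : 0 < `|e| by rewrite normr_gt0.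
pose f (t : R) := `|y + t *: e|.
have fB t s : 0 <= s -> f (t + s) + f (t - s) <=
    2 * f t + C * `|e| `^ p * m `^ (1 - p) * s `^ p.
  move=> s0; have ft0 : 0 < f t by exact: lt_le_trans (hm t).
  have := hC (y + t *: e) (s *: e); rewrite -!addrA -scalerDl -scalerBl.
  rewrite -normr_gt0 => /(_ ft0) /le_trans; apply; rewrite lerD2l.
  rewrite normrZ (ger0_norm s0) powRM//.
  have : f t `^ (1 - p) <= m `^ (1 - p).
    rewrite -(opprB p) !powRN lef_pV2 ?posrE ?powR_gt0//.
    by rewrite ge0_ler_powR ?nnegrE ?(ltW m0) ?(ltW ft0) ?hm//; lra.
  rewrite /f => /(ler_wpM2l (mulr_ge0 C0 (mulr_ge0 (powR_ge0 s p)
    (powR_ge0 `|e| p)))) /le_trans; apply.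
  by rewrite le_eqVlt; apply/orP; left; apply/eqP; ring.
(* With this [S] the triangle inequality gives [f S + f (- S) >= 2 S |e| = 2 |y| + 2], which exceeds
   [2 * f 0]. *)
pose S := (`|y| + 1) / `|e|.
have S0 : 0 <= S by rewrite divr_ge0 ?addr_ge0.
have := second_difference_le0 p2 fB 0 S0.
rewrite /f add0r sub0r scale0r addr0.
have := ler_normB (y + S *: e) (y + - S *: e).
rewrite opprD addrACA subrr add0r scaleNr opprK -scalerDl normrZ.
rewrite ger0_norm ?addr_ge0//.
have -> : (S + S) * `|e| = 2 * (`|y| + 1) by rewrite /S; field; rewrite gt_eqF.
lra.
Qed.

End dimension.

(** * Norming functionals from smoothness of the norm *)

Section norming_functional.
Context {R : realType} (Y : normedModType R).

Lemma topdual_of_bounded (u : Y -> R) (M : R) :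
  (forall a h g, u (a *: h + g) = a * u h + u g) ->
  (forall h, `|u h| <= M * `|h|) ->
  exists w : topdual Y, forall h, w h = u h.
Proof.
move=> ulin uM.
pose lu : {linear Y -> R^o} :=
  HB.pack (u : Y -> R^o) (GRing.isLinear.Build R Y R^o _ (u : Y -> R^o) ulin).
have cu : continuous lu.
  apply/bounded_linear_continuous/linear_boundedP.
  exists M; split=> [|r Mr h]; first exact: num_real.
  by apply: le_trans (uM h) _; rewrite ler_wpM2r// ltW.
by exists (Topdual cu).
Qed.

(* The functional is the one-sided directional derivative of the norm at y,
   which is sublinear; smoothness makes it odd, hence linear. *)
Lemma smooth_norming_functional (y : Y) (p B : R) : 1 < p ->
  (forall h, `|y + h| + `|y - h| <= 2 * `|y| + B * `|h| `^ p) ->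
  exists u : topdual Y, u y = `|y| /\ forall h, u h <= `|h|.
Proof.
(* By convexity [quot h t] is nondecreasing in [t], so its infimum over [t > 0] is the limit at 0
   from the right. *)
move=> p1 hB; pose quot h t := (`|y + t *: h| - `|y|) / t.
pose Q h := [set quot h t | t in [set t | 0 < t]].
pose u h := inf (Q h).
have quot_lb h t : 0 < t -> - `|h| <= quot h t.
  move=> t0; rewrite ler_pdivlMr// -(ger0_norm (ltW t0)) mulNr.
  have := ler_normB (y + t *: h) (t *: h).
  by rewrite addrK normrZ (ger0_norm (ltW t0)); lra.
have Q0 h : Q h !=set0 by exists (quot h 1), 1 => /=.
have Qinf h : has_inf (Q h).
  by split=> //; exists (- `|h|) => _ [t /= t0 <-]; exact: quot_lb.
have u_le h t : 0 < t -> u h <= quot h t.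
  by move=> t0; apply: ge_inf; [case: (Qinf h)|exists t].
have le_u h x : (forall t, 0 < t -> x <= quot h t) -> x <= u h.
  by move=> hx; apply: lb_le_inf => // _ [t /= t0 <-]; exact: hx.
have u_norm h : u h <= `|h|.
  apply: le_trans (u_le h 1 ltr01) _; rewrite /quot scale1r divr1.
  by have := ler_normD y h; lra.
have uD h g : u (h + g) <= u h + u g.
  rewrite -lerBlDl; apply: (le_u) => s s0; rewrite lerBlDl -lerBlDr.
  apply: le_u => t t0; rewrite lerBlDr.
  have ts0 : 0 < t + s by rewrite addr_gt0.
  (* For this step length, [y + r (h + g)] is the convex combination of [y + t h] and [y + s g] with
     weights [s / (t + s)] and [t / (t + s)]. *)
  have r0 : 0 < t * s / (t + s) by rewrite divr_gt0 ?mulr_gt0.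
  apply: le_trans (u_le _ _ r0) _; rewrite /quot ler_pdivrMr//.
  have : `|y + (t * s / (t + s)) *: (h + g)| <=
      s / (t + s) * `|y + t *: h| + t / (t + s) * `|y + s *: g|.
    rewrite -(ger0_norm (ltW (divr_gt0 s0 ts0))).
    rewrite -(ger0_norm (ltW (divr_gt0 t0 ts0))) -!normrZ.
    apply: le_trans _ (ler_normD _ _).
    rewrite !scalerDr addrACA -scalerDl !scalerA.
    have -> : s / (t + s) + t / (t + s) = 1 by field; rewrite gt_eqF.
    rewrite scale1r le_eqVlt; apply/orP; left; apply/eqP.
    congr (`| _ + (_ *: _ + _ *: _)|); field; by rewrite gt_eqF.
  move/le_trans => h1; rewrite lerBlDr; apply: h1.
  rewrite le_eqVlt; apply/orP; left; apply/eqP; field.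
  by rewrite !gt_eqF.
have u0 : u 0 = 0.
  apply/eqP; rewrite eq_le; apply/andP; split.
    by have := u_norm 0; rewrite normr0.
  by apply: le_u => t t0; rewrite /quot scaler0 addr0 subrr mul0r.
have uN h : u (- h) = - u h.
  apply/eqP; rewrite eq_le; apply/andP; split; last first.
    by have := uD h (- h); rewrite subrr u0; lra.
  rewrite -subr_le0 opprK.
  (* The quotients in the directions [h] and [- h] add up to a second difference divided by [t],
     which smoothness makes [O(t^(p - 1))]. *)
  have bnd t : 0 < t -> u (- h) + u h <= B * `|h| `^ p * t `^ (p - 1).
    move=> t0; apply: le_trans (lerD (u_le _ _ t0) (u_le _ _ t0)) _.
    rewrite /quot -mulrDl ler_pdivrMr// -[leRHS]mulrA (mulrC (t `^ _)).
    rewrite mulr_powRB1 ?(ltW t0)//; last by lra.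
    have := hB (t *: h); rewrite scalerN normrZ (ger0_norm (ltW t0)).
    by rewrite powRM ?(ltW t0)//; lra.
  by apply: le0_powR_near0 p1 _ => t t0 _; exact: bnd.
have uDE h g : u (h + g) = u h + u g.
  apply/eqP; rewrite eq_le uD /=.
  by have := uD (h + g) (- g); rewrite addrK uN; lra.
have uZ_le c h : 0 < c -> u (c *: h) <= c * u h.
  move=> c0; rewrite -ler_pdivrMl//; apply: le_u => t t0.
  rewrite ler_pdivrMl//; apply: le_trans (u_le _ _ (divr_gt0 t0 c0)) _.
  rewrite /quot scalerA divfK ?gt_eqF// le_eqVlt; apply/orP; left; apply/eqP.
  by field; rewrite !gt_eqF.
have uZ_gt0 c h : 0 < c -> u (c *: h) = c * u h.
  move=> c0; apply/eqP; rewrite eq_le uZ_le//=.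
  rewrite -ler_pdivlMl//; have ci0 : 0 < c^-1 by rewrite invr_gt0.
  by have := uZ_le _ (c *: h) ci0; rewrite scalerA mulVf ?gt_eqF// scale1r.
have uZ c h : u (c *: h) = c * u h.
  have [c0|c0|->] := ltgtP c 0; last by rewrite scale0r u0 mul0r.
    have := uZ_gt0 (- c) h.
    by rewrite oppr_gt0 scaleNr uN mulNr => /(_ c0)/oppr_inj.
  exact: uZ_gt0.
have [||w wu] := @topdual_of_bounded u 1.
- by move=> a h g; rewrite uDE uZ.
- move=> h; rewrite mul1r ler_norml u_norm andbT.
  by have := u_norm (- h); rewrite uN normrN; lra.
exists w; split=> [|h]; rewrite !wu//.
apply/eqP; rewrite eq_le u_norm /=; apply: le_u => t t0.
rewrite /quot -[X in `|X + _|]scale1r -scalerDl normrZ.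
rewrite ger0_norm ?addr_ge0 ?(ltW t0)//.
by rewrite le_eqVlt; apply/orP; left; apply/eqP; field; rewrite gt_eqF.
Qed.

End norming_functional.

(** * First-order expansion of the [p]-th power of the norm *)

Section power_of_norm.
Context {R : realType}.

(** The functional is [|k|^(p - 1) u] with [u] norming [k], and 0 at [k = 0]. Applying the scalar
    expansion to the increment of the norm adds 1 to [C]. *)
Lemma p_smooth_subgradient (Y : normedModType R) (p : R) :
  1 < p -> p_smooth Y p -> (2 < p -> ~ one_dimensional Y) ->
  exists2 C : R, 0 <= C & forall k : Y, exists w : topdual Y,
    (forall z, p^-1 * `|k| `^ p + w (z - k) <= p^-1 * `|z| `^ p) /\
    (forall h, p^-1 * `|k + h| `^ p <=
               p^-1 * `|k| `^ p + w h + C * `|h| `^ p).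
Proof.
move=> p1 hY hdim; have p0 : 0 < p by lra.
have pV1 : p^-1 <= 1 by rewrite invf_le1 ?ltW.
have [C C0 hC] := p_smooth_homogeneous p1 hY; exists (C + 1) => [|k].
  by rewrite addr_ge0.
have [->|kN0] := eqVneq k 0.
  have [||w w0] := @topdual_of_bounded R Y (fun=> 0) 0.
  - by move=> *; rewrite mulr0 addr0.
  - by move=> *; rewrite normr0 mul0r.
  exists w; split=> h; rewrite w0 normr0 powR0 ?gt_eqF// mulr0 !add0r.
    by rewrite mulr_ge0 ?invr_ge0 ?powR_ge0 ?ltW.
  by rewrite ler_wpM2r ?powR_ge0// (le_trans pV1) ?lerDr.
(* The scalar expansion requires [p <= 2]; beyond 2 the space is trivial, against [k != 0]. *)
have p12 : 1 < p <= 2.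
  rewrite p1 leNgt; apply/negP => p2.
  by move/eqP: kN0; apply; exact: p_smooth_trivial p2 hY (hdim p2) k.
have k0 : 0 < `|k| by rewrite normr_gt0.
have [u [uk u_norm]] : exists u : topdual Y,
    u k = `|k| /\ forall h, u h <= `|h|.
  apply: (@smooth_norming_functional _ _ _ p (C * `|k| `^ (1 - p))) => // h.
  by rewrite mulrAC; exact: hC.
set s := `|k| in uk k0 *.
have [||w wE] := @topdual_of_bounded R Y
  (fun h => s `^ (p - 1) * u h) (s `^ (p - 1)).
- by move=> a h g; rewrite linearP; rewrite /= /GRing.scale/=; ring.
- move=> h; rewrite normrM ger0_norm ?powR_ge0// ler_wpM2l ?powR_ge0//.
  by rewrite ler_norml u_norm andbT lerNl -linearN -[leRHS]normrN.
exists w; split=> [z|h]; rewrite wE -(ler_pM2l p0) !mulrDr !mulVKf ?gt_eqF//.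
  have := powR_tangent p1 (normr_ge0 z) (ltW k0).
  have : s `^ (p - 1) * u (z - k) <= s `^ (p - 1) * (`|z| - s).
    by rewrite ler_wpM2l ?powR_ge0// linearB /= uk lerD2r.
  by move=> /(ler_wpM2l (ltW p0)); lra.
have kh : 0 <= s + (`|k + h| - s) by rewrite subrKC.
have := powR_expand p12 (ltW k0) kh; rewrite subrKC.
have : `| `|k + h| - s| `^ p <= `|h| `^ p.
  rewrite ge0_ler_powR ?nnegrE ?(ltW p0)//.
  by have := ler_dist_dist (k + h) k; rewrite addrAC subrr add0r.
(* Since [|k - h| >= u (k - h) = s - u h], the second-difference bound becomes a one-sided
   first-order bound on [|k + h|]. *)
have : s `^ (p - 1) * (`|k + h| - s) <=
    s `^ (p - 1) * (u h + C * `|h| `^ p * s `^ (1 - p)).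
  rewrite ler_wpM2l ?powR_ge0//; have := hC k h kN0; rewrite -/s.
  by have := u_norm (k - h); rewrite linearB /= uk; lra.
have -> : s `^ (p - 1) * (u h + C * `|h| `^ p * s `^ (1 - p)) =
    s `^ (p - 1) * u h + C * `|h| `^ p.
  rewrite -(opprB p) powRN; field.
  by rewrite powR_eq0 (gt_eqF k0).
move=> /(ler_wpM2l (ltW p0)) e1 /(ler_wpM2l (ltW p0)).
lra.
Qed.

End power_of_norm.

(** * Dual norm and duality mapping *)

Section duality.
Context {R : realType}.

Lemma conjugate_exponentM (p q : R) : 1 < p -> p^-1 + q^-1 = 1 ->
  (q - 1) * (p - 1) = 1.
Proof.
move=> p1 pq; have -> : q = p / (p - 1); last by field; lra.
rewrite -[q]invrK (_ : q^-1 = 1 - p^-1); last by rewrite -pq addrC addKr.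
by field; lra.
Qed.

Lemma topdualZ (Y : normedModType R) (w : topdual Y) a h :
  w (a *: h) = a * w h.
Proof. by rewrite linearZ. Qed.

(** [sup] is a least upper bound only for nonempty sets bounded above; continuity of [w] supplies
    the bound. *)
Lemma dual_norm_has_ub (Y : normedModType R) (w : topdual Y) :
  has_ubound [set `|w v| | v in [set v : Y | `|v| <= 1]].
Proof.
have /linear_bounded_continuous/linear_boundedP/pinfty_ex_gt0[r r0 hr] :=
  @topdual_continuous _ _ w.
exists r => _ [v /= v1 <-]; apply: le_trans (hr v) _.
by rewrite -[leRHS]mulr1 ler_wpM2l// ltW.
Qed.

Lemma dual_norm_ge0 (Y : normedModType R) (w : topdual Y) : 0 <= dual_norm w.
Proof.
apply: (ub_le_sup (dual_norm_has_ub w)).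
by exists 0; rewrite /= ?linear0 ?normr0.
Qed.

Lemma le_dual_norm (Y : normedModType R) (w : topdual Y) h :
  `|w h| <= dual_norm w * `|h|.
Proof.
have [->|hN0] := eqVneq h 0; first by rewrite linear0 !normr0 mulr0.
have h0 : 0 < `|h| by rewrite normr_gt0.
have unit : `| `|h|^-1 *: h| = 1.
  by rewrite normrZ ger0_norm ?invr_ge0// mulVf ?gt_eqF.
rewrite -ler_pdivrMr// mulrC -[X in X * _]ger0_norm ?invr_ge0//.
rewrite -normrM -topdualZ; apply: (ub_le_sup (dual_norm_has_ub w)).
by exists (`|h|^-1 *: h); rewrite //= unit.
Qed.

(** By conjugacy of the exponents the norm condition reads [dual_norm w = |j|^(p - 1)]; the scalar
    tangent inequality at [|j|] then applies. *)
Lemma duality_map_subgradient (Y : normedModType R) (p q : R) (w : topdual Y)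
    (j : Y) : 1 < p -> p^-1 + q^-1 = 1 -> duality_map q w j ->
  forall z, p^-1 * `|j| `^ p + w (z - j) <= p^-1 * `|z| `^ p.
Proof.
move=> p1 pq [wj jE] z; have p0 : 0 < p by lra.
have wN : dual_norm w = `|j| `^ (p - 1).
  rewrite jE -powRrM conjugate_exponentM// powRr1//; exact: dual_norm_ge0.
have tangent := powR_tangent p1 (normr_ge0 z) (normr_ge0 j).
have : w z <= `|j| `^ (p - 1) * `|z|.
  by rewrite -wN (le_trans (ler_norm _))// le_dual_norm.
move=> /(ler_wpM2l (ltW p0)) wz.
rewrite -(ler_pM2l p0) mulrDr !mulVKf ?gt_eqF// linearB /= wj wN; lra.
Qed.

End duality.

(** * Convex conjugates and optimality of Tikhonov minimisers *)

Section convexity.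
Context {R : realType}.

(** Equality case of Fenchel-Young: the subgradient inequality says that the supremum is attained at
    [x]. *)
Lemma conjugate_subgradient (V : normedModType R) (f : V -> \bar R) (x : V)
    (xi : topdual V) : subdifferential f x xi ->
  conjugate f xi = ((xi x)%:E - f x)%E.
Proof.
move=> [fx hx]; apply/eqP; rewrite eq_le; apply/andP; split; last first.
  by apply: ereal_sup_ubound; exists x.
apply: ge_ereal_sup => _ [z _ <-]; have := hx z; rewrite linearB.
case: (f x) fx => // r _; case: (f z) => [s| |]; last by rewrite leeNy_eq.
  by rewrite -!EFinD !lee_fin /=; lra.
by rewrite addeNy leNye.
Qed.

(** The supremum is tested at [Phi t], where [pinv] returns [t] because strict monotonicity makes
    [Phi] injective. *)
Lemma index_inv_conjugate_ge (Phi : R -> R) (s t : R) :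
  {in halfline &, {homo Phi : x y / x < y}} -> 0 <= t ->
  ((s * Phi t - t)%:E <= index_inv_conjugate Phi s)%E.
Proof.
move=> incr t0; have ht : t \in halfline by rewrite inE /halfline/= in_itv/= t0.
apply: ereal_sup_ubound; exists (Phi t); first by exists t => //; rewrite -inE.
congr (_ - _)%:E; apply: pinvKV ht => x y hx hy xy.
by case: (ltgtP x y) => // [/(incr _ _ hx hy)|/(incr _ _ hy hx)];
  rewrite xy ltxx.
Qed.

(** Minimality is tested at [x + t (z - x)]: convexity bounds the penalty, the last hypothesis
    bounds the misfit up to [O(t^p)]; divide by [t] and let [t] tend to 0. *)
Lemma tikhonov_minimiser_subgradient (X Y : normedModType R)
    (A : {linear X -> Y}) (hA : bounded_near A (nbhs (0 : X)))
    (f : X -> \bar R) (p alpha C : R) (y : Y) (x : X) (w : topdual Y) :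
  1 < p -> 0 < alpha -> (forall z, (0 <= f z)%E) -> convex_efun f ->
  f x \is a fin_num -> argmin [set: X] (tikhonov A f p alpha y) x ->
  (forall h, p^-1 * `|A x - y + h| `^ p <=
             p^-1 * `|A x - y| `^ p - alpha * w h + C * `|h| `^ p) ->
  subdifferential f x (adjoint hA w).
Proof.
move=> p1 alpha0 f0 fconv fx [_ xmin] hw; split=> // z.
case fzE : (f z) => [fz| |]; rewrite ?leey//; last first.
  by have := f0 z; rewrite fzE.
rewrite -(fineK fx) -EFinD lee_fin /=; set r := fine (f x).
rewrite -subr_le0 -(pmulr_rle0 _ alpha0).
apply: (@le0_powR_near0 R p _ (C * `|A (z - x)| `^ p) p1) => t t0 t1.
have := fconv z x t; rewrite fzE -(fineK fx) -/r -!EFinM -EFinD ltW ?(ltW t1)//.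
move=> /(_ isT).
have := xmin (t *: z + (1 - t) *: x) I; rewrite /tikhonov -(fineK fx) -/r.
have := f0 (t *: z + (1 - t) *: x).
case: (f _) => // g _; rewrite -!EFinM -!EFinD !lee_fin.
have -> : A (t *: z + (1 - t) *: x) - y = A x - y + t *: A (z - x).
  rewrite scalerBl scale1r addrCA -scalerBr linearD linearZ /=.
  by rewrite addrAC.
have := hw (t *: A (z - x)); rewrite topdualZ normrZ powRM//.
rewrite ger0_norm ?(ltW t0)// -[t `^ p](mulr_powRB1 (ltW t0)); last by lra.
move=> h1 h2 /(ler_wpM2l (ltW alpha0)) h3; rewrite -(ler_pM2l t0); lra.
Qed.

End convexity.

(** * Monotonicity gap of two subgradients, and the error estimate *)

Section dual_estimate.
Context {R : realType}.

(** The inequality at [k] is tested at [j], the one at [j] is tested at [k + h]; with the upper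
    bound at [k + h] all values of [g] cancel. The increment [h] stays free to absorb the noise. *)
Lemma subgradient_coercivity (Y : normedModType R) (g : Y -> R) (G : R)
    (w v : topdual Y) (k j h : Y) :
  (forall z, g k + w (z - k) <= g z) -> (forall z, g j + v (z - j) <= g z) ->
  g (k + h) <= g k + w h + G -> - (w h - v h) - G <= (w k - v k) - (w j - v j).
Proof.
move=> /(_ j) gk /(_ (k + h)) gj gkh; move: gk gj gkh.
rewrite addrAC !linearD !linearN /=; lra.
Qed.

End dual_estimate.

Theorem theorem4p4 (R : realType) (Y : completeNormedModType R) (p q : R)
    (hp : 1 < p) (hpq : p^-1 + q^-1 = 1) (hY : p_smooth Y p)
    (hdim : 2 < p -> ~ one_dimensional Y) :
  exists D : R,
  forall (X : completeNormedModType R)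
    (A : {linear X -> Y}) (hA : bounded_near A (nbhs (0 : X)))
    (Rf : X -> \bar R)
    (hRf0 : forall x, (0 <= Rf x)%E)
    (hRfconv : convex_efun Rf)
    (hRflsc : lower_semicontinuous Rf)
    (hRfcoer : coercive Rf)
    (ydag : Y) (xdag : X)
    (hxdag : R_minimising_solution A Rf ydag xdag)
    (wdag : topdual Y)
    (hwdag : subdifferential Rf xdag (adjoint hA wdag))
    (j : Y) (hj : duality_map q wdag j)
    (Phi : R -> R) (hPhi : index_function Phi)
    (hineq : forall (w : topdual Y) (d : R),
       dual_bregman Rf xdag (adjoint hA w) (adjoint hA wdag) = d%:E ->
       wdag j - w j <= Phi d)
    (alpha delta : R) (halpha : 0 < alpha) (hdelta : 0 < delta)
    (ydelta : Y) (hydelta : `|ydelta - ydag| <= delta)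
    (x : X) (hx : argmin [set: X] (tikhonov A Rf p alpha ydelta) x),
  (bregman Rf (adjoint hA wdag) x xdag <=
     index_inv_conjugate Phi (alpha `^ (q - 1)) +
     (D * (delta `^ p / alpha))%:E)%E.
Proof.
have p0 : 0 < p by lra.
have pq1 := conjugate_exponentM hp hpq.
have [C C0 hC] := p_smooth_subgradient hp hY hdim.
exists C => X A hA Rf hRf0 hRfconv _ _ ydag xdag [Axdag _] wdag hwdag j hj.
move=> Phi [Phi_incr _ _ _ _] hineq alpha delta alpha0 _ ydelta hydelta x hx.
(* This scale gives [a^(p - 1) = alpha], so the misfit at the residual [- a k] has gradient
   [- alpha w]. *)
pose a := alpha `^ (q - 1); have a0 : 0 < a by rewrite powR_gt0.
have ap1 : a `^ (p - 1) = alpha by rewrite -powRrM pq1 powRr1// ltW.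
have ap : a `^ p = a * alpha by rewrite -ap1 mulr_powRB1// ltW.
have [k rk] : exists k, A x - ydelta = - a *: k.
  exists (- a^-1 *: (A x - ydelta)).
  by rewrite scalerA mulrNN divff ?scale1r ?gt_eqF.
have [w [wk wh]] := hC k.
have [fxdag _] := hwdag.
have fx : Rf x \is a fin_num.
  have := hx.2 xdag I; rewrite /tikhonov -(fineK fxdag).
  have := hRf0 x; case: (Rf x) => // _.
  by rewrite -EFinM -EFinD gt0_muley ?lte_fin// addey// leye_eq.
have hw : subdifferential Rf x (adjoint hA w).
  apply: (tikhonov_minimiser_subgradient (A := A) (C := C) hA hp alpha0
    hRf0 hRfconv fx hx).
  move=> h; rewrite rk.
  (* The expansion at [k] with increment [- h / a] is multiplied by [a^p]: the linear term becomes
     [- alpha * w h], and the remainder keeps the constant [C]. *)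
  have -> : - a *: k + h = - a *: (k + - a^-1 *: h).
    by rewrite scalerDr scalerA mulrNN divff ?scale1r ?gt_eqF.
  have := wh (- a^-1 *: h); rewrite !normrZ topdualZ normrN !powRM//.
  rewrite normrN normfV !(ger0_norm (ltW a0)).
  move=> /(ler_wpM2l (powR_ge0 a p)) bound.
  rewrite mulrCA; apply: le_trans bound _.
  have -> : a^-1 `^ p = (a `^ p)^-1.
    by rewrite -[in LHS]powR_inv1 ?(ltW a0)// -powRrM mulN1r powRN.
  rewrite ap le_eqVlt; apply/orP; left; apply/eqP; field.
  by rewrite !gt_eqF.
set rx := fine (Rf x); set rd := fine (Rf xdag).
(* Both conjugates are explicit by Fenchel-Young equality, so the dual Bregman distance is also the
   primal one of [xdag] from [x] at [A^* w], hence non-negative. *)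
pose d := rd - rx + w (A (x - xdag)).
have dE : dual_bregman Rf xdag (adjoint hA w) (adjoint hA wdag) = d%:E.
  rewrite /dual_bregman (conjugate_subgradient hw) (conjugate_subgradient hwdag).
  rewrite -(fineK fx) -(fineK fxdag) -/rx -/rd -!EFinB; congr (_%:E).
  by rewrite /d /= !linearB /=; ring.
have d0 : 0 <= d.
  have := hw.2 xdag; rewrite -(fineK fx) -(fineK fxdag) -/rx -/rd.
  by rewrite -EFinD lee_fin /d /= !linearB /=; lra.
have Phid := hineq w d dE.
(* Psi at [a] is replaced by its lower bound [a * Phi d - d], leaving an inequality between
   reals. *)
apply: le_trans (leeD2r _ (index_inv_conjugate_ge _ Phi_incr d0)).
rewrite /bregman -(fineK fx) -(fineK fxdag) -/rx -/rd -!EFinB -EFinD lee_fin.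
rewrite -/a.
have [e Axe e_delta] : exists2 e, A (x - xdag) = - a *: k + e & `|e| <= delta.
  exists (ydelta - ydag) => //.
  by rewrite -rk linearB /= Axdag addrA subrK.
(* After multiplication by [a], this increment yields exactly [w e - wdag e] and the remainder
   [C |e|^p / alpha]. *)
have gh := wh (- a^-1 *: e).
have := subgradient_coercivity wk (duality_map_subgradient hp hpq hj) gh.
rewrite -(ler_pM2l a0) !topdualZ normrZ normrN powRM//.
rewrite ger0_norm ?invr_ge0 ?(ltW a0)//.
have eC : C * `|e| `^ p <= C * delta `^ p.
  rewrite ler_wpM2l// ge0_ler_powR ?nnegrE ?(ltW p0)//.
  exact: le_trans e_delta.
have -> : a^-1 `^ p = (a * alpha)^-1.
  by rewrite -ap -[in LHS]powR_inv1 ?(ltW a0)// -powRrM mulN1r powRN.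
(* Hence the Bregman distance plus [d] equals [(w - wdag) (e - a k)], which the preceding inequality
   bounds. *)
have dv : d = rd - rx + (w e - a * w k).
  by rewrite /d Axe linearD /= topdualZ; ring.
clearbody d; rewrite /= Axe !linearD !linearN /= !topdualZ.
have -> : C * (delta `^ p / alpha) = alpha^-1 * (C * delta `^ p).
  by rewrite [RHS]mulrC mulrA.
have alphaV0 : 0 <= alpha^-1 by rewrite invr_ge0 ltW.
move: (ler_wpM2l alphaV0 eC) (ler_wpM2l (ltW a0) Phid).
have -> : a * (- (- a^-1 * w e) - - (- a^-1 * wdag e) -
      C * ((a * alpha)^-1 * `|e| `^ p))
    = w e - wdag e - alpha^-1 * (C * `|e| `^ p).
  by field; rewrite !gt_eqF.
rewrite {}dv; lra.
Qed.
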